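(* Let $L$ be a principally generated TAFL. Then $\dim(L)\leq 1$.
   Context: A multiplicative lattice is a set $L$ with a commutative associative multiplication and a partial order $\leq$ such that $(L,\leq)$ is a complete lattice with greatest element $1$ and least element $0$, and such that $1x=x$ and $x(\bigvee E)=\bigvee\{xe\mid e\in E\}$ for all $x\in L$ and $E\subseteq L$. An element $a\in L$ is compact if for each $F\subseteq L$ with $a\leq\bigvee F$ there is a finite $E\subseteq F$ with $a\leq\bigvee E$. A subset is multiplicatively closed if it contains $1$ and is closed under products. $L$ is a C-lattice if there is a multiplicatively closed subset $C\subseteq L$ of compact elements such that every element of $L$ is a join of elements of $C$. For $a,b\in L$, $(a:b)=\bigvee\{x\in L\mid xb\leq a\}$. An element $e\in L$ is principal if $a\wedge be=((a:e)\wedge b)e$ and $((a\vee be):e)=(a:e)\vee b$ for all $a,b\in L$. $L$ is principally generated if every element of $L$ is a join of principal elements. An element $a$ is proper if $a<1$. A proper element $p$ is prime if for all $a,b\in L$, $ab\leq p$ implies $a\leq p$ or $b\leq p$. A proper element $p$ is a TA-element ($2$-absorbing element) if for all $a,b,c\in L$, $abc\leq p$ implies $ab\leq p$ or $bc\leq p$ or $ac\leq p$. A TAFL is a C-lattice in which every element is a finite product of TA-elements (the element $1$ being the empty product). $\dim(L)$ is the supremum of all $n\in\mathbb{N}$ such that there is a strict chain $p_0<p_1<\dots<p_n$ of prime elements of $L$ (of length $n$). *)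

(* Defs.v *)
From HB Require Import structures.
From mathcomp Require Export all_boot all_order all_algebra.
From mathcomp Require Export boolp classical_sets cardinality constructive_ereal.

Set Implicit Arguments.
Unset Strict Implicit.
Unset Printing Implicit Defensive.

Import Order.TTheory.

Declare Scope mlattice_scope.
Delimit Scope mlattice_scope with ML.
Local Open Scope classical_set_scope.
Local Open Scope mlattice_scope.

(* [\top] and [\bot] are the greatest element 1 and the least element 0;
   [0 = 1] is not excluded.  Since every set has a supremum,
   [supremum \bot E] is the join of [E]; the default value [\bot] is only used
   for the empty set, where it is the join. *)
HB.mixin Record TBLattice_isMultLattice d L of Order.TBLattice d L := {
  mmul : L -> L -> L;
  mmulA : associative mmul;
  mmulC : commutative mmul;
  mmul1x : left_id (\top%O : L) mmul;
  has_supremums : forall E : set L, supremums E !=set0;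
  has_infimums : forall E : set L, infimums E !=set0;
  mmul_supremum : forall (x : L) (E : set L),
    mmul x (supremum \bot%O E) = supremum \bot%O [set mmul x e | e in E]
}.

#[short(type="multLatticeType")]
HB.structure Definition MultLattice d :=
  { L of TBLattice_isMultLattice d L & Order.TBLattice d L }.

HB.instance Definition _ d (L : multLatticeType d) :=
  Monoid.isComLaw.Build L \top%O (@mmul d L) (@mmulA d L) (@mmulC d L)
    (@mmul1x d L).

Infix "**" := mmul (at level 40, left associativity) : mlattice_scope.

Section MultLatticeDefs.
Context {d : Order.disp_t} {L : multLatticeType d}.
Implicit Types (a b c e p x : L) (C E F : set L).

Definition join_of E : L := supremum \bot%O E.

Lemma join_ofP E : supremums E (join_of E).
Proof.
rewrite /join_of /supremum; case: ifPn => [/eqP ->|_].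
  by split=> [x []|x _]; exact: Order.le0x.
by have [x Ex] := has_supremums E; exact: (xgetI _ Ex).
Qed.

Definition compact_element a :=
  forall F, (a <= join_of F)%O ->
    exists E, [/\ finite_set E, E `<=` F & (a <= join_of E)%O].

Definition mult_closed C :=
  C \top%O /\ (forall x y, C x -> C y -> C (x ** y)).

Definition resid a b : L := join_of [set x | (x ** b <= a)%O].

Definition principal_element e :=
  (forall a b, Order.meet a (b ** e) = Order.meet (resid a e) b ** e) /\
  (forall a b, resid (Order.join a (b ** e)) e = Order.join (resid a e) b).

Definition proper_element a := (a < \top)%O.

Definition prime_element p :=
  proper_element p /\
  (forall a b, (a ** b <= p)%O -> (a <= p)%O \/ (b <= p)%O).

Definition TA_element p :=
  proper_element p /\
  (forall a b c, (a ** b ** c <= p)%O ->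
     [\/ (a ** b <= p)%O, (b ** c <= p)%O | (a ** c <= p)%O]).

End MultLatticeDefs.

Section MultLatticeClasses.
Context {d : Order.disp_t} (L : multLatticeType d).

Definition generated_by (C : set L) :=
  forall x : L, exists2 E : set L, E `<=` C & x = join_of E.

Definition C_lattice :=
  exists C : set L,
    [/\ mult_closed C, C `<=` [set a | compact_element a] & generated_by C].

Definition principally_generated :=
  generated_by [set e : L | principal_element e].

Definition TAFL :=
  C_lattice /\
  (forall x : L, exists s : seq L,
     (forall p, p \in s -> TA_element p) /\ x = \big[mmul / \top%O]_(p <- s) p).

Definition has_prime_chain (n : nat) :=
  exists s : seq L,
    [/\ size s = n.+1, sorted <%O s & forall p, p \in s -> prime_element p].

Definition chain_lengths : set (\bar int) :=
  [set (Posz n)%:E | n in has_prime_chain].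

(* The supremum is taken in the extended integers, so it is [+oo] when the
   lengths are unbounded, and [-oo] when there is no prime element. *)
Definition mdim : \bar int := supremum -oo%E chain_lengths.

Lemma mdimP : supremums chain_lengths mdim.
Proof.
rewrite /mdim /supremum; case: ifPn => [/eqP ->|/set0P[_ [n0 Hn0 _]]].
  by split=> [x []|x _]; exact: leNye.
suff [x Hx] : supremums chain_lengths !=set0 by exact: (xgetI _ Hx).
have mem n : has_prime_chain n -> chain_lengths (Posz n)%:E by move=> Hn; exists n.
have [ub|nub] := pselect (ubound has_prime_chain !=set0).
  have [m [mub mlb]] := nat_supremums_neq0 ub.
  exists (Posz m)%:E; split=> [_ [n Hn <-]|y yub].
    by rewrite lee_fin; exact: mub.
  case: y yub => [[k|k]| |] yub; [|by have := yub _ (mem _ Hn0)|exact: leey|by have := yub _ (mem _ Hn0)].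
  by rewrite lee_fin; apply: mlb => n /mem /yub; rewrite lee_fin.
exists +oo%E; split=> [x _|y yub]; first exact: leey.
case: y yub => [z| |] yub //; last by have := yub _ (mem _ Hn0).
exfalso; apply: nub; exists `|z|%N => n /mem /yub.
by rewrite lee_fin; case: (z).
Qed.

End MultLatticeClasses.

(* Main.v *)
Require Import Defs.

(* Let p0 < p1 < p2 be primes.  A TA-element has at most two minimal primes, so,
   elements being products of TA-elements, every element has finitely many.
   Hence there are compact y <= p1 below no minimal prime of the lattice, and
   compact x <= p2 below no minimal prime over y.  Let m be minimal over
   y \/ x, and p < m minimal over y; calculate in the localization at m.  If t
   is a TA-element over which m is minimal, then m^2 <= t, and an element that
   is not below m^2 has a single TA-factor below m.  Nakayama's lemma gives
   m <> m^2, and a principal z <= m with z not below m^2 turns out to have m as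
   its only prime, so m^2 <= z, while p <= m^2.  A TA-factor t <= p of y then
   satisfies t = (t : z) z and (t : z) = ((t : z) : z) z <= t because z^2 is
   not below p; so t <= tm, y <= ym and y = 0 locally, contradicting the choice
   of y.  One cannot reduce to the case p0 = 0: L need not be modular, and
   principal elements of L need not remain principal above p0. *)

Set Implicit Arguments.
Unset Strict Implicit.
Unset Printing Implicit Defensive.

Import Order.TTheory.
Local Open Scope classical_set_scope.
Local Open Scope order_scope.
Local Open Scope mlattice_scope.

(** * Arithmetic of joins, residuals and compact elements *)

Section Arithmetic.
Context {d : Order.disp_t} {L : multLatticeType d}.
Implicit Types (a b c e p q r s t x y z : L) (E F : set L).

Lemma join_of_leP E b : join_of E <= b <-> (forall e, E e -> e <= b).
Proof.
have [ub lub] := join_ofP E; split=> [Eb e Ee|Eb]; last exact: lub.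
exact: le_trans (ub _ Ee) Eb.
Qed.

Lemma le_join_of E e : E e -> e <= join_of E.
Proof. by have [ub _] := join_ofP E => /ub. Qed.

Lemma mmul_join_leP x E b :
  x ** join_of E <= b <-> (forall e, E e -> x ** e <= b).
Proof.
rewrite /join_of mmul_supremum; split=> [/join_of_leP H e Ee|H].
  by apply: H; exists e.
by apply/join_of_leP => _ [e Ee <-]; exact: H.
Qed.

Lemma join_of_pair a b : join_of [set a; b] = a `|` b.
Proof.
apply/le_anti/andP; split; last first.
  by rewrite leUx !le_join_of //=; [right|left].
by apply/join_of_leP => _ [->|->]; rewrite ?leUl ?leUr.
Qed.

Lemma mmul_leUP x a b c : x ** (a `|` b) <= c <-> x ** a <= c /\ x ** b <= c.
Proof.
rewrite -join_of_pair; split=> [/mmul_join_leP H|[xa xb]].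
  by split; apply: H; [left|right].
by apply/mmul_join_leP => _ [->|->].
Qed.

Lemma mmulUr x a b : x ** (a `|` b) = x ** a `|` x ** b.
Proof.
apply/le_anti/andP; split.
  by apply/mmul_leUP; rewrite leUl leUr.
have /mmul_leUP[xa xb] := lexx (x ** (a `|` b)).
by rewrite leUx xa xb.
Qed.

Lemma mmulUl x a b : (a `|` b) ** x = a ** x `|` b ** x.
Proof. by rewrite mmulC mmulUr !(mmulC x). Qed.

Lemma mmulx1 x : x ** \top = x.
Proof. by rewrite mmulC mmul1x. Qed.

Lemma mmulCA x y z : x ** (y ** z) = y ** (x ** z).
Proof. by rewrite !mmulA (mmulC x). Qed.

Lemma mmulACA x y z t : x ** y ** (z ** t) = x ** z ** (y ** t).
Proof. by rewrite -!mmulA (mmulCA y). Qed.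

Lemma le_mmul2l x a b : a <= b -> x ** a <= x ** b.
Proof. by move=> /join_r <-; rewrite mmulUr leUl. Qed.

Lemma le_mmul2r x a b : a <= b -> a ** x <= b ** x.
Proof. by rewrite !(mmulC _ x); exact: le_mmul2l. Qed.

Lemma le_mmul a b c e : a <= b -> c <= e -> a ** c <= b ** e.
Proof. by move=> ab ce; exact: le_trans (le_mmul2r c ab) (le_mmul2l b ce). Qed.

Lemma le_mmull a b : a ** b <= b.
Proof. by rewrite -[leRHS]mmul1x le_mmul2r ?lex1. Qed.

Lemma le_mmulr a b : a ** b <= a.
Proof. by rewrite mmulC le_mmull. Qed.

Lemma mmulx0 x : x ** \bot = \bot.
Proof. by apply/le_anti; rewrite le0x le_mmull. Qed.

(** Products distribute over joins, so the join defining [resid a b] lies itself in the set that is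
    joined. *)
Lemma residP x a b : x <= resid a b <-> x ** b <= a.
Proof.
split=> [/(le_mmul2r b) xb|xb]; last exact: le_join_of.
apply: le_trans xb _; rewrite mmulC; apply/mmul_join_leP => e /=.
by rewrite mmulC.
Qed.

Lemma resid_mull a b : resid a b ** b <= a.
Proof. exact/residP. Qed.

Lemma le_bigprod (l : seq L) t : t \in l -> \big[mmul / \top]_(u <- l) u <= t.
Proof.
elim: l => // u l IHl; rewrite inE big_cons => /orP[/eqP ->|/IHl ltl].
  exact: le_mmulr.
exact: le_trans (le_mmull _ _) ltl.
Qed.

Lemma mmul_bigjoin x (l : seq L) :
  x ** \join_(u <- l) u = \join_(u <- l) (x ** u).
Proof. by elim/big_rec2: _ => [|u _ y _ <-]; rewrite ?mmulx0 ?mmulUr. Qed.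

Lemma bigjoin_set (l : seq L) : join_of [set` l] = \join_(u <- l) u.
Proof.
apply/le_anti/andP; split; first by apply/join_of_leP => u ul;
  exact: (joins_sup_seq id).
by apply/joinsP_seq => u ul _; exact: le_join_of.
Qed.

Lemma finite_join F E : finite_set E -> E `<=` F ->
  exists2 l : seq L, {in l, forall u, F u} & join_of E = \join_(u <- l) u.
Proof.
move=> /finite_seqP[l ->] lF; exists l; last exact: bigjoin_set.
by move=> u /lF.
Qed.

Lemma compactP a : compact_element a <->
  (forall F, a <= join_of F ->
   exists2 l : seq L, {in l, forall u, F u} & a <= \join_(u <- l) u).
Proof.
split=> ca F aF.
  have [E [finE EF aE]] := ca _ aF.
  by have [l lF eqE] := finite_join finE EF; exists l; rewrite -?eqE.
have [l lF al] := ca _ aF.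
exists [set` l]; split; [exact: finite_seq|by move=> u /= /lF|].
by rewrite bigjoin_set.
Qed.

Lemma compact_bot : compact_element (\bot : L).
Proof. by apply/compactP => F _; exists [::]; rewrite ?big_nil. Qed.

Lemma compact_join a b :
  compact_element a -> compact_element b -> compact_element (a `|` b).
Proof.
move=> /compactP ca /compactP cb; apply/compactP => F.
rewrite leUx => /andP[/ca[l lF al] /cb[k kF bk]].
exists (l ++ k); first by move=> u; rewrite mem_cat => /orP[/lF|/kF].
by rewrite big_cat /= leU2.
Qed.

Lemma compact_bigjoin (l : seq L) (F : L -> L) :
  {in l, forall u, compact_element (F u)} ->
  compact_element (\join_(u <- l) F u).
Proof.
elim: l => [|u l IHl] cl; first by rewrite big_nil; exact: compact_bot.
rewrite big_cons; apply: compact_join; first by apply: cl; rewrite inE eqxx.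
by apply: IHl => v vl; apply: cl; rewrite inE vl orbT.
Qed.

Lemma compact_generated F a : generated_by F -> compact_element a ->
  exists2 l : seq L, {in l, forall u, F u} & a = \join_(u <- l) u.
Proof.
move=> genF /compactP ca; have [E EF aE] := genF a.
have [|l lE al] := ca E; first by rewrite -aE.
exists l; first by move=> u /lE /EF.
apply/le_anti; rewrite al aE; apply/joinsP_seq => u ul _.
by apply: le_join_of; exact: lE.
Qed.

Lemma generated_le F a b : generated_by F ->
  (forall e, F e -> e <= a -> e <= b) -> a <= b.
Proof.
move=> genF ab; have [E EF aE] := genF a.
rewrite {1}aE; apply/join_of_leP => e Ee.
by apply: ab; [exact: EF|rewrite aE; exact: le_join_of].
Qed.

Lemma generated_nle F a b : generated_by F -> ~~ (a <= b) ->
  exists e, [/\ F e, e <= a & ~~ (e <= b)].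
Proof.
move=> genF nab; apply: contrapT => H; move/negP: nab; apply.
apply: (generated_le genF) => e Fe ea; apply/negPn/negP => neb.
by apply: H; exists e.
Qed.

Lemma prime_nle_mul p a b : prime_element p ->
  ~~ (a <= p) -> ~~ (b <= p) -> ~~ (a ** b <= p).
Proof. by move=> [_ pp] nap nbp; apply/negP => /pp[]; apply/negP. Qed.

Lemma prime_sqr p a : prime_element p -> a ** a <= p -> a <= p.
Proof. by move=> [_ pp] /pp[]. Qed.

Lemma top_nle_prime p : prime_element p -> ~~ (\top <= p).
Proof. by move=> [p1 _]; rewrite (lt_geF p1). Qed.

End Arithmetic.

(** * Zorn's lemma on a subset, and existence of minimal primes *)

Lemma Zorn_in (T : Type) (R : rel T) (P : set T) :
  (forall t, R t t) -> (forall r s t, R r s -> R s t -> R r t) ->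
  (forall s t, R s t -> R t s -> s = t) ->
  (forall A : set T, A `<=` P -> total_on A R ->
    exists2 t, P t & forall s, A s -> R s t) ->
  exists2 t, P t & forall s, P s -> R t s -> s = t.
Proof.
move=> Rxx Rtrans Ranti ubP.
pose S (u v : {x | P x}) := R (sval u) (sval v).
have [|||A totA|[t Pt] maxt] := @Zorn {x | P x} S.
- by move=> u; exact: Rxx.
- by move=> u v w; exact: Rtrans.
- by move=> [u Pu] [v Pv] Suv Svu; apply: eq_exist; exact: Ranti.
- have [|_ _ [u Au <-] [v Av <-]|t Pt ubt] := ubP [set sval u | u in A].
  + by move=> _ [[u Pu] _ <-].
  + exact: totA.
  + by exists (exist _ t Pt) => u Au; apply: ubt; exists u.
by exists t => // s Ps Rts; have /(congr1 sval) := maxt (exist _ s Ps) Rts.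
Qed.

Definition minimal_over {d : Order.disp_t} {L : multLatticeType d} (a q : L) :=
  [/\ prime_element q, a <= q &
      forall r, prime_element r -> a <= r -> r <= q -> r = q].

Section Primes.
Context {d : Order.disp_t} {L : multLatticeType d}.
Implicit Types (a b c e p q r s t x y z : L) (E F : set L).

Lemma minimal_over_le a b q :
  minimal_over a q -> a <= b -> b <= q -> minimal_over b q.
Proof.
move=> [pq _ minq] ab bq; split=> // r pr br; apply: minq => //.
exact: le_trans br.
Qed.

(** Zorn's lemma downwards. The meet of a chain of primes is prime: if neither factor is below the
    meet, each fails to be below some member, and the smaller of these two members is above neither
    factor. *)
Lemma exists_minimal_over a q : prime_element q -> a <= q ->
  exists2 r, minimal_over a r & r <= q.
Proof.
move=> pq aq.
have [||||r [pr ar rq] minr] :=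
    @Zorn_in L >=%O [set r | [/\ prime_element r, a <= r & r <= q]].
- exact: lexx.
- by move=> r s t rs st; exact: le_trans st rs.
- by move=> s t st ts; apply/le_anti/andP.
- move=> A Aq totA; have [A0|/set0P[r0 Ar0]] := eqVneq A set0.
    by exists q => // s; rewrite A0.
  have [g [lbg glb]] := has_infimums A.
  have [pr0 ar0 r0q] := Aq _ Ar0.
  exists g; last by move=> s /lbg.
  split; last exact: le_trans (lbg _ Ar0) r0q.
  - split=> [|x y xyg]; first exact: le_lt_trans (lbg _ Ar0) pr0.1.
    have [xg|nxg] := boolP (x <= g); [by left|right].
    apply: (glb _) => r Ar; apply/negPn/negP => nyr.
    have [r' Ar' nxr'] : exists2 r', A r' & ~~ (x <= r').
      apply: contrapT => H; move/negP: nxg; apply; apply: (glb _) => s As.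
      by apply/negPn/negP => nxs; apply: H; exists s.
    have noth s : A s -> ~~ (x <= s) -> ~~ (y <= s) -> False.
      move=> As nxs nys; have [ps _ _] := Aq _ As.
      by move/negP: (prime_nle_mul ps nxs nys); apply;
        exact: le_trans xyg (lbg _ As).
    case: (totA _ _ Ar Ar') => rr'.
    + by apply: (noth r') => //; apply: contra nyr => /le_trans; apply.
    + by apply: (noth r) => //; apply: contra nxr' => /le_trans; apply.
  - by apply: glb => s /Aq[].
exists r => //; split=> // s ps a_s sr; apply: minr => //; split=> //.
exact: le_trans sr rq.
Qed.

End Primes.

(** * Prime separation in C-lattices and TA-elements at a minimal prime *)

Section Compact.
Context {d : Order.disp_t} {L : multLatticeType d}.
Context (clat : C_lattice L).
Implicit Types (a b c e p q r s t x y z : L) (E F : set L).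

Lemma compact_top : compact_element (\top : L).
Proof. by have [C [[C1 _] Cc _]] := clat; exact: Cc. Qed.

Lemma compact_mul a b :
  compact_element a -> compact_element b -> compact_element (a ** b).
Proof.
have [C [[_ CM] Cc genC]] := clat => ca cb.
have [l lC ->] := compact_generated genC ca.
have [k kC ->] := compact_generated genC cb.
rewrite mmulC mmul_bigjoin; apply: compact_bigjoin => u ul.
rewrite mmulC mmul_bigjoin; apply: compact_bigjoin => v vk.
by apply/Cc/CM; [exact: lC|exact: kC].
Qed.

Lemma compact_gen : generated_by [set a : L | compact_element a].
Proof.
have [C [_ Cc genC]] := clat => x; have [E EC xE] := genC x.
by exists E => // e /EC /Cc.
Qed.

Lemma compact_pow a n :
  compact_element a -> compact_element (iter n (mmul a) \top).
Proof.
move=> ca; elim: n => [|n IHn]; first exact: compact_top.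
by rewrite iterS; exact: compact_mul.
Qed.

Lemma mmul_pow a n k :
  iter n (mmul a) \top ** iter k (mmul a) \top = iter (n + k) (mmul a) \top.
Proof.
by elim: n => [|n IHn]; rewrite ?mmul1x // addSn !iterS -mmulA IHn.
Qed.

(** Krull's argument for the multiplicative system of all [s c^n] with [s] compact and not below
    [q]: an element above [t], maximal among those with no member of the system below them, is
    prime. The members are compact, so the property passes to joins of chains. *)
Lemma krull_separation t q c : prime_element q -> t <= q -> compact_element c ->
  (forall s n, compact_element s -> ~~ (s <= q) ->
     ~~ (s ** iter n (mmul c) \top <= t)) ->
  exists r, [/\ prime_element r, t <= r, r <= q & ~~ (c <= r)].
Proof.
move=> pq tq cc sep.
pose P b := t <= b /\ forall s n, compact_element s -> ~~ (s <= q) ->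
  ~~ (s ** iter n (mmul c) \top <= b).
have [||||r [tr sepr] maxr] := @Zorn_in L <=%O P.
- exact: lexx.
- by move=> r s u; exact: le_trans.
- by move=> s u su us; apply/le_anti/andP.
- move=> A AP totA; have [A0|/set0P[a0 Aa0]] := eqVneq A set0.
    by exists t => // s; rewrite A0.
  exists (join_of A); last by move=> s; exact: le_join_of.
  have [ta0 _] := AP _ Aa0.
  split=> [|s n cs nsq]; first exact: le_trans ta0 (le_join_of Aa0).
  have [cpt _] := compactP (s ** iter n (mmul c) \top).
  apply/negP => /(cpt (compact_mul cs (compact_pow cc)))[l lA].
  have [b Ab lb] : exists2 b, A b & \join_(u <- l) u <= b.
    elim: l lA => [|u l IHl] ulA; first by exists a0; rewrite ?big_nil ?le0x.
    have [|b Ab lb] := IHl; first by move=> v vl; apply: ulA; rewrite inE vl orbT.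
    have Au : A u by apply: ulA; rewrite inE eqxx.
    rewrite big_cons; case: (totA _ _ Au Ab) => ub.
    + by exists b; rewrite // leUx ub lb.
    + by exists u; rewrite // leUx lexx (le_trans lb ub).
  move=> /le_trans /(_ lb); apply/negP; exact: (AP _ Ab).2.
(* The member with [s = 1], [n = 1] keeps [c] out of [r]; those with [n = 0] force [r <= q]. *)
have ncr : ~~ (c <= r).
  have := sepr \top 1 compact_top (top_nle_prime pq).
  by rewrite mmul1x /= mmulx1.
have rq : r <= q.
  apply/negPn/negP => /(generated_nle compact_gen)[s [cs sr nsq]].
  by have := sepr s 0 cs nsq; rewrite /= mmulx1 sr.
exists r; split=> //; split=> [|a b abr]; first exact: le_lt_trans rq pq.1.
have [ar|nar] := boolP (a <= r); [by left|right].
apply/negPn/negP => nbr.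
(* By maximality of [r], any strictly larger [r \/ e] has a member of the system below it. *)
have big e : ~~ (e <= r) -> exists s n, [/\ compact_element s, ~~ (s <= q) &
    s ** iter n (mmul c) \top <= r `|` e].
  move=> ner; apply: contrapT => H; move/negP: ner; apply.
  suff <- : r `|` e = r by rewrite leUr.
  apply: maxr; last exact: leUl.
  split=> [|s n cs nsq]; first exact: le_trans tr (leUl _ _).
  by apply/negP => le; apply: H; exists s, n.
have [s [n [cs nsq sra]]] := big _ nar.
have [u [k [cu nuq urb]]] := big _ nbr.
have := sepr (s ** u) (n + k) (compact_mul cs cu) (prime_nle_mul pq nsq nuq).
move/negP; apply; rewrite -mmul_pow mmulACA.
apply: le_trans (le_mmul sra urb) _.
by rewrite mmulUl !mmulUr !leUx le_mmulr le_mmull le_mmulr abr.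
Qed.

(** Otherwise separation yields a prime over [t] and below [q] that avoids [c], against minimality
    of [q]. *)
Lemma minimal_over_pow t q c : minimal_over t q -> compact_element c -> c <= q ->
  exists s n, ~~ (s <= q) /\ s ** iter n (mmul c) \top <= t.
Proof.
move=> [pq tq minq] cc cq; apply: contrapT => H.
have [|r [pr tr rq ncr]] := krull_separation pq tq cc.
  by move=> s n _ nsq; apply/negP => le; apply: H; exists s, n.
by move: ncr; rewrite (minq r) ?cq.
Qed.

(** For [k > 2], splitting [s c^k] as [(s c^(k-2)) c c] and using the TA property either lowers the
    exponent by one or gives [c^2 <= t]. *)
Lemma TA_minimal_sqr t q c : TA_element t -> minimal_over t q ->
  compact_element c -> c <= q -> exists2 s, ~~ (s <= q) & s ** (c ** c) <= t.
Proof.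
move=> [_ TAt] mq cc cq.
have [s [n [nsq sct]]] := minimal_over_pow mq cc cq; exists s => //.
(* Raising the exponent to [n.+2] makes [c^2] the base case of the induction. *)
have {sct} : s ** iter n.+2 (mmul c) \top <= t.
  apply: le_trans sct; apply: le_mmul2l.
  by rewrite !iterS mmulA le_mmull.
elim: n => [|n IHn]; first by rewrite /= mmulx1.
have mid k : s ** iter k (mmul c) \top ** c = s ** iter k.+1 (mmul c) \top.
  by rewrite -mmulA (mmulC _ c).
rewrite -(mid n.+2) -(mid n.+1) => /TAt[]; rewrite ?mid => // ccs.
exact: le_trans (le_mmull _ _) ccs.
Qed.

End Compact.

(** * Localization at a prime [m] and Nakayama's lemma *)

Section Localization.
Context {d : Order.disp_t} {L : multLatticeType d}.
Context (clat : C_lattice L) (m : L) (pm : prime_element m).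
Implicit Types (a b c e q r s t x y z : L).

(* [loc b] is the contraction to [L] of the localization of [b] at [m], so
   [a <= loc b] says that [a <= b] holds locally at [m]. *)
Definition loc b : L := join_of [set x | exists2 s, ~~ (s <= m) & s ** x <= b].

Lemma le_loc_of s a b : ~~ (s <= m) -> s ** a <= b -> a <= loc b.
Proof. by move=> nsm sab; apply: le_join_of; exists s. Qed.

Lemma le_loc a b : a <= b -> a <= loc b.
Proof. by move=> ab; apply: (@le_loc_of \top); rewrite ?mmul1x ?top_nle_prime. Qed.

(** Compactness leaves finitely many multipliers; their product serves for all and is not below the
    prime [m]. *)
Lemma compact_le_loc c b : compact_element c -> c <= loc b ->
  exists2 s, ~~ (s <= m) & s ** c <= b.
Proof.
move=> /compactP cc /cc[l lb cl].
suff [s nsm sl] : exists2 s, ~~ (s <= m) & s ** \join_(u <- l) u <= b.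
  by exists s => //; apply: le_trans (le_mmul2l _ cl) sl.
elim: l lb {cl} => [|u l IHl] ulb.
  by exists \top; rewrite ?big_nil ?mmulx0 ?le0x ?(top_nle_prime pm).
have [|s nsm slb] := IHl; first by move=> v vl; apply: ulb; rewrite inE vl orbT.
have [|r nrm rub] := ulb u; first by rewrite inE eqxx.
exists (r ** s); first exact: prime_nle_mul.
rewrite big_cons; apply/mmul_leUP; split; first rewrite (mmulC r); rewrite -mmulA.
  exact: le_trans (le_mmull _ _) rub.
exact: le_trans (le_mmull _ _) slb.
Qed.

Lemma le_loc_trans b a c : a <= loc b -> b <= loc c -> a <= loc c.
Proof.
move=> ab bc; apply: (generated_le (compact_gen clat)) => e ce ea.
have [s nsm seb] := compact_le_loc ce (le_trans ea ab).
(* A compact multiplier [r <= s] makes [r ** e] compact, so that [compact_le_loc] applies a second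
   time. *)
have [r [cr rs nrm]] := generated_nle (compact_gen clat) nsm.
have [|u num ure] := @compact_le_loc (r ** e) c (compact_mul clat cr ce).
  by apply: le_trans bc; apply: le_trans (le_mmul2r _ rs) seb.
by apply: (@le_loc_of (u ** r)); [exact: prime_nle_mul|rewrite -mmulA].
Qed.

Lemma loc_le a b c : a <= loc b -> b <= c -> a <= loc c.
Proof. by move=> ab /le_loc; exact: le_loc_trans. Qed.

Lemma le_loc_mul a b x : a <= loc b -> a ** x <= loc (b ** x).
Proof.
move=> /(le_mmul2r x) /le_trans; apply.
rewrite mmulC; apply/mmul_join_leP => e [s nsm seb].
by apply: (le_loc_of nsm); rewrite mmulCA (mmulC x) le_mmul2r.
Qed.

Lemma le_loc_mul2 a b x y : a <= loc b -> x <= loc y -> a ** x <= loc (b ** y).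
Proof.
move=> /(le_loc_mul x) ab /(le_loc_mul b); rewrite (mmulC x) (mmulC y).
exact: le_loc_trans.
Qed.

Lemma loc_prime q a : prime_element q -> q <= m -> a <= loc q -> a <= q.
Proof.
move=> [_ pq] qm /le_trans; apply; apply/join_of_leP => e [s nsm /pq[] // sq].
by rewrite (le_trans sq qm) in nsm.
Qed.

(** Principal generators are eliminated one at a time: the second principal identity turns
    [s e <= B \/ m e] into [s <= (B : e) \/ m], so the multiplier [(B : e)] is not below [m] and
    carries [e] below [B]. *)
Lemma nakayama_seq (l : seq L) b s : {in l, forall e, principal_element e} ->
  ~~ (s <= m) -> s ** \join_(e <- l) e <= b `|` (\join_(e <- l) e) ** m ->
  exists2 r, ~~ (r <= m) & r ** \join_(e <- l) e <= b.
Proof.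
elim: l b s => [|e l IHl] b s pl nsm.
  by exists s; rewrite ?big_nil ?mmulx0 ?le0x.
have [_ je] : principal_element e by apply: pl; rewrite inE eqxx.
have {}pl : {in l, forall u, principal_element u}.
  by move=> u ul; apply: pl; rewrite inE ul orbT.
rewrite !big_cons; set a := \join_(u <- l) u => /mmul_leUP[].
have -> : b `|` (e `|` a) ** m = b `|` a ** m `|` m ** e.
  by rewrite mmulUl (mmulC e) joinCA joinC.
set B := b `|` a ** m => /residP; rewrite je => sB saB.
have nrm : ~~ (resid B e <= m).
  by apply: contra nsm => rm; apply: le_trans sB _; rewrite leUx rm /=.
(* Multiplication by [(B : e)] absorbs the term [m e] into [B], which leaves the hypothesis for the
   shorter list. *)
have [||u num ua] := IHl b (resid B e ** s) pl; first exact: prime_nle_mul.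
  rewrite -mmulA; apply: le_trans (le_mmul2l _ saB) _.
  by rewrite mmulUr leUx le_mmull mmulCA (le_trans (le_mmull _ _) (resid_mull _ _)).
exists (u ** resid B e); first exact: prime_nle_mul.
rewrite mmulUr leUx -mmulA; apply/andP; split; last first.
  by rewrite (mmulC u) -mmulA (le_trans (le_mmull _ _) ua).
apply: le_trans (le_mmul2l _ (resid_mull _ _)) _.
by rewrite mmulUr leUx le_mmull mmulA (le_trans (le_mmulr _ _) ua).
Qed.

Context (hprin : principally_generated L).

Lemma nakayama a b : compact_element a -> a <= loc (b `|` a ** m) -> a <= loc b.
Proof.
move=> ca /(compact_le_loc ca)[s nsm]; have [l pl ->] := compact_generated hprin ca.
by move=> /(nakayama_seq pl nsm)[r nrm]; exact: le_loc_of.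
Qed.

(** For compact [c] and [e] below [m], [c e] is below the square of the compact element [c \/ e],
    which [TA_minimal_sqr] handles; [m^2] is the join of such products. *)
Lemma minimal_TA_sqr t : TA_element t -> minimal_over t m -> m ** m <= loc t.
Proof.
move=> TAt mt.
have cd c e : compact_element c -> compact_element e -> c <= m -> e <= m ->
    c ** e <= loc t.
  move=> cc ce cm em.
  have [|s nsm st] := TA_minimal_sqr clat TAt mt (compact_join cc ce).
    by rewrite leUx cm.
  apply: (le_loc_of nsm); apply: le_trans st.
  by apply/le_mmul2l/le_mmul; rewrite ?leUl ?leUr.
have [E cE mE] := compact_gen clat m.
have Em e : E e -> e <= m by rewrite mE; exact: le_join_of.
have -> : m ** m = join_of E ** join_of E by rewrite -mE.
apply/mmul_join_leP => e Ee.
rewrite mmulC; apply/mmul_join_leP => c Ec.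
by apply: cd; [exact: cE|exact: cE|exact: Em|exact: Em].
Qed.

(** * Factorization into TA-elements, locally at [m] *)

Context (hTA : forall x : L, exists s : seq L,
  (forall p, p \in s -> TA_element p) /\ x = \big[mmul / \top]_(p <- s) p).

(** Two factors below [m] would put the product below [m^2]; so only one is, and all others become
    units locally. *)
Lemma bigprod_loc_factor (l : seq L) :
  \big[mmul / \top]_(u <- l) u <= m ->
  ~~ (\big[mmul / \top]_(u <- l) u <= loc (m ** m)) ->
  exists t, [/\ t \in l, t <= m & t <= loc (\big[mmul / \top]_(u <- l) u)].
Proof.
elim: l => [|t l IHl]; first by rewrite big_nil (negPf (top_nle_prime pm)).
rewrite big_cons; set P := \big[mmul / \top]_(u <- l) u => tPm ntPmm.
have [tm|ntm] := boolP (t <= m).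
  exists t; split; rewrite // ?inE ?eqxx //.
  apply: (@le_loc_of P); last by rewrite mmulC.
  by apply: contra ntPmm => Pm; exact: (le_loc (le_mmul tm Pm)).
have Pm : P <= m by have [_ /(_ _ _ tPm)[|//]] := pm; rewrite (negPf ntm).
have [|u [ul um uP]] := IHl Pm.
  by apply: contra ntPmm; exact: le_trans (le_mmull _ _).
exists u; split; rewrite // ?inE ?ul ?orbT //.
by apply: le_loc_trans uP _; exact: (le_loc_of ntm).
Qed.

Lemma minimal_sqr w : minimal_over w m -> ~~ (w <= loc (m ** m)) ->
  m ** m <= loc w.
Proof.
move=> mw nw; have [l [TAl wl]] := hTA w; have [_ wm _] := mw.
rewrite wl in wm nw *.
have [t [tl tm tw]] := bigprod_loc_factor wm nw.
apply: le_loc_trans tw; apply: minimal_TA_sqr; first exact: TAl.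
by apply: minimal_over_le mw _ tm; rewrite wl le_bigprod.
Qed.

(** Serves to discard compact generators one by one until [m] is minimal over [z] alone. *)
Lemma minimal_drop z e : compact_element e -> ~~ (z <= loc (m ** m)) ->
  minimal_over (z `|` e) m -> minimal_over z m.
Proof.
move=> ce nz [_ zem mine]; have := zem; rewrite leUx => /andP[zm em].
(* Locally [e^2 <= m^2 <= z \/ e^3], so [e <= q] for every prime [q >= z]. *)
have mw : minimal_over (z `|` e ** e ** e) m.
  split=> //; first by rewrite leUx zm (le_trans (le_mmull _ _) em).
  move=> q pq; rewrite leUx => /andP[zq eeeq]; apply: mine => //.
  by rewrite leUx zq; case: (pq) => _ /(_ _ _ eeeq)[/(prime_sqr pq)|].
have mmw : m ** m <= loc (z `|` e ** e ** e).
  by apply: minimal_sqr => //; apply: contra nz; exact: le_trans (leUl _ _).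
split=> // q pq zq qm; apply: mine => //; rewrite leUx zq; apply: prime_sqr => //.
apply: (loc_prime pq qm); apply: nakayama; first exact: compact_mul.
apply: loc_le (le_trans (le_mmul em em) mmw) _.
by rewrite leU2 ?le_mmul2l.
Qed.

(** The first principal identity at [b = 1] reads [a /\ z = (a : z) z], and locally [a] is below
    this meet. *)
Lemma loc_principal z a : principal_element z -> a <= loc z ->
  a <= loc (resid a z ** z).
Proof.
move=> [mz _] az; apply: (generated_le (compact_gen clat)) => e ce ea.
have [s nsm sez] := compact_le_loc ce (le_trans ea az).
apply: (le_loc_of nsm); rewrite -[resid a z]meetx1 -mz mmul1x lexI sez andbT.
exact: le_trans (le_mmull _ _) ea.
Qed.

Lemma prime_bigprod q (l : seq L) : prime_element q ->
  \big[mmul / \top]_(u <- l) u <= q ->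
  exists t c, [/\ t \in l, t <= q & \big[mmul / \top]_(u <- l) u = t ** c].
Proof.
move=> pq; elim: l => [|t l IHl]; first by rewrite big_nil (negPf (top_nle_prime pq)).
rewrite big_cons => tlq; have [_ /(_ _ _ tlq)[tq|/IHl]] := pq.
  by exists t; eexists; split; rewrite ?inE ?eqxx.
move=> [u [c [ul uq ->]]]; exists u, (t ** c).
by rewrite inE ul orbT mmulCA.
Qed.

(** If [m = m^2] locally, every TA-factor of [y \/ x] is locally above [m], hence so is their
    product. Then [x <= m^2 <= (y \/ x) m <= y \/ x m] locally, and Nakayama gives [x <= y <= p]. *)
Lemma max_nle_loc_sqr p x y : prime_element p -> p <= m -> y <= p ->
  compact_element x -> ~~ (x <= p) -> minimal_over (y `|` x) m ->
  ~~ (m <= loc (m ** m)).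
Proof.
move=> pp plm yp cx nxp myx; apply/negP => mmm.
have [_ yxm _] := myx; have [l [TAl yxl]] := hTA (y `|` x).
have ml : m <= loc (y `|` x).
  have : {in l, forall t, m <= loc t}.
    move=> t tl; have [tm|ntm] := boolP (t <= m).
      apply: le_loc_trans mmm _; apply: minimal_TA_sqr; first exact: TAl.
      by apply: minimal_over_le myx _ tm; rewrite yxl le_bigprod.
    exact: le_loc_of ntm (le_mmulr _ _).
  rewrite yxl; elim: (l) => [_|t k IHk mtk]; first by rewrite big_nil le_loc ?lex1.
  rewrite big_cons; apply: le_loc_trans mmm _; apply: le_loc_mul2.
    by apply: mtk; rewrite inE eqxx.
  by apply: IHk => u uk; apply: mtk; rewrite inE uk orbT.
have xm : x <= m by apply: le_trans yxm; exact: leUr.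
move/negP: nxp; apply; apply: (loc_prime pp plm).
apply: loc_le (nakayama cx _) yp.
apply: le_loc_trans (le_trans xm mmm) _.
apply: loc_le (le_loc_mul m ml) _.
by rewrite mmulUl leU2 ?le_mmulr.
Qed.

(** Here [y] separates [p] from [r] and [x] separates [m] from [p]; the contradiction is [y = 0]
    locally, as this would put [y] below [r]. *)
Lemma no_prime_between p r x y : prime_element p -> prime_element r ->
  r <= p -> p <= m -> compact_element x -> compact_element y ->
  y <= p -> ~~ (y <= r) -> ~~ (x <= p) -> ~ minimal_over (y `|` x) m.
Proof.
move=> pp pr rp plm cx cy yp nyr nxp myx.
have [_ yxm _] := myx; have := yxm; rewrite leUx => /andP[ym xm].
have nmm := max_nle_loc_sqr pp plm yp cx nxp myx.
(* The principal [z] is found below a compact [c], since a compact element above [z] is wanted when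
   [minimal_drop] is applied to [p]. *)
have [c [cc cm ncmm]] := generated_nle (compact_gen clat) nmm.
have [z [prz zc nzmm]] := generated_nle hprin ncmm.
have zm := le_trans zc cm.
have mz : minimal_over z m.
  apply: (minimal_drop cy nzmm); apply: (minimal_drop cx).
    by apply: contra nzmm; exact: le_trans (leUl _ _).
  by apply: minimal_over_le myx _ _; rewrite -?joinA ?leUr ?leUx ?zm ?ym.
have nmin q : prime_element q -> z <= q -> q <= m -> q = m by case: mz => _ _; exact.
have nzp : ~~ (z <= p).
  by apply: contra nxp => /(nmin _ pp) -> //.
(* Otherwise dropping [c] from [p \/ c], which lies between [z] and [m], makes [m] minimal over [p];
   then [p = m], although [x] is below [m] only. *)
have pmm : p <= loc (m ** m).
  apply/negPn/negP => npmm.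
  have [] : minimal_over p m.
    apply: (minimal_drop cc npmm); apply: minimal_over_le mz _ _.
      exact: le_trans zc (leUr _ _).
    by rewrite leUx plm.
  by move=> _ _ /(_ _ pp (lexx _) plm) pE; rewrite pE xm in nxp.
have pz : p <= loc z by apply: le_loc_trans pmm _; exact: minimal_sqr.
have [l [TAl yl]] := hTA y.
have [|t [c' [tl tp yt]]] := @prime_bigprod p l pp; first by rewrite -yl.
have t1p : resid t z <= p.
  have := le_trans (resid_mull t z) tp; case: (pp) => _ /[apply]-[] //.
  by rewrite (negPf nzp).
(* The TA property for [((t : z) : z) z z <= t] leaves [((t : z) : z) z <= t], since [z^2 <= t]
   would put [z] below [p]. *)
have t1t : resid t z <= loc t.
  apply: loc_le (loc_principal prz (le_trans t1p pz)) _.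
  have [_ TAt] := TAl _ tl.
  have /TAt[] // : resid (resid t z) z ** z ** z <= t.
    exact: le_trans (le_mmul2r _ (resid_mull _ _)) (resid_mull _ _).
  by move=> /le_trans /(_ tp) /(prime_sqr pp); rewrite (negPf nzp).
have ttm : t <= loc (t ** m).
  apply: le_loc_trans (loc_principal prz (le_trans tp pz)) _.
  apply: loc_le (le_loc_mul z t1t) _; exact: le_mmul2l.
(* Multiplying [t <= t m] by the cofactor [c'] gives [y <= y m] locally: Nakayama with [b = 0]. *)
have y0 : y <= loc \bot.
  apply: (nakayama cy); rewrite join0x yl yt -mmulA (mmulC c') mmulA.
  exact: le_loc_mul.
move/negP: nyr; apply; apply: (loc_prime pr (le_trans rp plm)).
exact: loc_le y0 (le0x _).
Qed.

End Localization.

(** * Finiteness of the set of minimal primes over an element *)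

Section MinimalPrimes.
Context {d : Order.disp_t} {L : multLatticeType d}.
Context (clat : C_lattice L).
Implicit Types (a b c e p q r s t x y z : L).

Lemma minimal_over_nle t q r : minimal_over t q -> minimal_over t r ->
  q <> r -> ~~ (q <= r).
Proof.
move=> [pq tq _] [_ _ minr] qr; apply/negP => le; apply: qr.
exact: minr.
Qed.

Lemma compact_avoid q (l : seq L) : exists c, [/\ compact_element c, c <= q &
  {in l, forall r, ~~ (q <= r) -> ~~ (c <= r)}].
Proof.
elim: l => [|r l [c [cc cq cl]]].
  by exists \bot; split; [exact: compact_bot|exact: le0x|].
have [qr|/(generated_nle (compact_gen clat))[e [ce eq ner]]] := boolP (q <= r).
  by exists c; split=> // u; rewrite inE => /orP[/eqP ->|/cl //]; rewrite qr.
exists (c `|` e); split; [exact: compact_join|by rewrite leUx cq|].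
move=> u; rewrite inE => /orP[/eqP -> _|/cl ncu /ncu].
  by apply: contra ner; exact: le_trans (leUr _ _).
by apply: contra; exact: le_trans (leUl _ _).
Qed.

Lemma TA_minimal_mul t q c : TA_element t -> minimal_over t q ->
  compact_element c -> c <= q -> ~~ (c ** c <= t) ->
  exists2 s, ~~ (s <= q) & s ** c <= t.
Proof.
move=> TAt mq cc cq ncc; have [s nsq] := TA_minimal_sqr clat TAt mq cc cq.
rewrite mmulA; have [_ H] := TAt => /H[sct|cct|sct]; try by exists s.
by rewrite cct in ncc.
Qed.

(** For distinct primes, take [b] below [p] alone and [c] below [q] alone, with multipliers [s] and
    [u] carrying them below [t]. The partial products of [(s \/ u) b c] are excluded at [q], [r] and
    [p] in turn. *)
Lemma TA_minimal3 t p q r : TA_element t -> minimal_over t p ->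
  minimal_over t q -> minimal_over t r -> [\/ p = q, q = r | p = r].
Proof.
move=> TAt mp mq mr; apply: contrapT => H.
have pq : p <> q by move=> pq; apply: H; constructor 1.
have qr : q <> r by move=> qr; apply: H; constructor 2.
have pr : p <> r by move=> pr; apply: H; constructor 3.
have [pp tp _] := mp; have [prq tq _] := mq; have [prr tr _] := mr.
have [b [cb bp nb]] := compact_avoid p [:: q; r].
have [c [cc cq nc]] := compact_avoid q [:: p; r].
have nbq : ~~ (b <= q) by apply: nb; rewrite ?inE ?eqxx ?(minimal_over_nle mp mq).
have nbr : ~~ (b <= r) by apply: nb; rewrite ?inE ?eqxx ?orbT ?(minimal_over_nle mp mr).
have ncp : ~~ (c <= p) by apply: nc; rewrite ?inE ?eqxx ?(minimal_over_nle mq mp) //;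
  exact: nesym.
have ncr : ~~ (c <= r) by apply: nc; rewrite ?inE ?eqxx ?orbT ?(minimal_over_nle mq mr).
have nt e s u : prime_element s -> t <= s -> ~~ (e <= s) -> ~~ (u <= s) ->
    ~~ (e ** u <= t).
  by move=> ps ts es us; apply: contra (prime_nle_mul ps es us) => /le_trans; apply.
have [s nsp sb] := TA_minimal_mul TAt mp cb bp (nt _ _ _ prq tq nbq nbq).
have [u nuq uc] := TA_minimal_mul TAt mq cc cq (nt _ _ _ pp tp ncp ncp).
(* [(s \/ u) b c <= t], although none of the three partial products is. *)
have [_ /(_ (s `|` u) b c)] := TAt; rewrite !mmulUl !leUx.
case.
- rewrite (le_trans (le_mmulr _ _) sb) -mmulA (mmulC b) mmulA.
  by rewrite (le_trans (le_mmulr _ _) uc).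
- by move=> /andP[_]; rewrite (negPf (nt _ _ _ prq tq nuq nbq)).
- by rewrite (negPf (nt _ _ _ prr tr nbr ncr)).
- by move=> /andP[]; rewrite (negPf (nt _ _ _ pp tp nsp ncp)).
Qed.

Lemma TA_minimal_finite t : TA_element t ->
  exists l : seq L, forall q, minimal_over t q -> q \in l.
Proof.
move=> TAt; have [[p mp]|no] := pselect (exists q, minimal_over t q); last first.
  by exists [::] => q mq; case: no; exists q.
have [[q [mq pq]]|no] := pselect (exists q, minimal_over t q /\ p <> q); last first.
  exists [:: p] => q mq; rewrite inE; apply/eqP; apply: contrapT => qp.
  by apply: no; exists q; split=> // /esym.
exists [:: p; q] => r mr; rewrite !inE.
by have [] := TA_minimal3 TAt mp mq mr => // ->; rewrite eqxx ?orbT.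
Qed.

(** A minimal prime over the product is above some factor, and is minimal over that factor. *)
Lemma minimal_finite a (l : seq L) : {in l, forall t, TA_element t} ->
  a = \big[mmul / \top]_(t <- l) t ->
  exists k : seq L, forall q, minimal_over a q -> q \in k.
Proof.
move=> TAl al.
have [k kP] : exists k : seq L, forall t q, t \in l -> minimal_over t q -> q \in k.
  elim: l TAl {al} => [|t l IHl] TAl; first by exists [::].
  have [|k kP] := IHl; first by move=> u ul; apply: TAl; rewrite inE ul orbT.
  have [|j jP] := @TA_minimal_finite t; first by apply: TAl; rewrite inE eqxx.
  exists (j ++ k) => u q; rewrite inE mem_cat => /orP[/eqP ->|ul] mq.
    by rewrite jP.
  by rewrite (kP u) ?orbT.
exists k => q mq; have [pq aq _] := mq.
have [|t [c [tl tq _]]] := @prime_bigprod _ _ q l pq; first by rewrite -al.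
by apply: (kP t) => //; apply: minimal_over_le mq _ tq; rewrite al le_bigprod.
Qed.

End MinimalPrimes.

(** * Chains of three primes and the dimension bound *)

Lemma no_prime_chain3 (d : Order.disp_t) (L : multLatticeType d) (p q r : L) :
  principally_generated L -> TAFL L ->
  prime_element p -> prime_element q -> prime_element r ->
  p < q -> q < r -> False.
Proof.
move=> hprin [clat hTA] pp pq pr ltpq ltqr.
have avoid (a s : L) : prime_element s ->
    (forall t, minimal_over a t -> ~~ (s <= t)) ->
    exists c, [/\ compact_element c, c <= s &
      forall t, minimal_over a t -> ~~ (c <= t)].
  move=> ps ns; have [l [TAl al]] := hTA a.
  have [k kP] := minimal_finite clat TAl al.
  have [c [cc cs ck]] := compact_avoid clat s k.
  by exists c; split=> // t mt; apply: ck (kP _ mt) (ns _ mt).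
(* A minimal prime [t] of the lattice with [q <= t] would equal [p] by minimality, against [p < q];
   the choice of [x] below is alike. *)
have [|y [cy yq ny]] := @avoid \bot q pq.
  move=> t [_ _ mint]; apply/negP => qt.
  move: (ltpq); rewrite (mint p) ?le0x ?(le_trans (ltW ltpq)) //.
  by rewrite (le_gtF qt).
have [|x [cx xr nx]] := @avoid y r pr.
  move=> t [_ _ mint]; apply/negP => rt.
  move: (ltqr); rewrite (mint q) ?(le_trans (ltW ltqr)) //.
  by rewrite (le_gtF rt).
have [|m mm _] := @exists_minimal_over _ _ (y `|` x) r pr.
  by rewrite leUx xr (le_trans yq (ltW ltqr)).
have [pm yxm _] := mm; have := yxm; rewrite leUx => /andP[ym _].
(* The given chain is replaced by [p0 <= p1 <= m] with [p1] minimal over [y] and [p0] minimal over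
   0, so that [x] and [y] avoid them by construction. *)
have [p1 mp1 p1m] := exists_minimal_over pm ym.
have [pp1 yp1 _] := mp1.
have [p0 mp0 p01] := exists_minimal_over pp1 (le0x p1).
have [pp0 _ _] := mp0.
exact: (no_prime_between clat pm hprin hTA pp1 pp0 p01 p1m
  cx cy yp1 (ny _ mp0) (nx _ mp1)).
Qed.

Theorem proposition3p4 (d : Order.disp_t) (L : multLatticeType d)
  (hprin : principally_generated L) (hTAFL : TAFL L) :
  (mdim L <= 1%:E)%E.
Proof.
have [_ lub] := mdimP L; apply: lub => _ [n [s [sz srt ps]] <-].
rewrite lee_fin lez_nat leqNgt; apply/negP => n1.
(* A chain of length [n > 1] has [n + 1 >= 3] members, so its first three exist. *)
case: s sz srt ps => [|p [|q [|r s]]] //=; try by move=> [nE]; rewrite -nE in n1.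
move=> _ /and3P[pq qr _] ps.
apply: (no_prime_chain3 hprin hTAFL _ _ _ pq qr);
  by apply: ps; rewrite !inE eqxx ?orbT.
Qed.
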